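(* Let $X$ and $Y$ be independent random variables, each with the unit Fréchet distribution $F(x)=e^{-1/x}$, $x>0$, and let $(X_i,Y_i)$, $i=1,\dots,n$, be a random sample (i.i.d. copies) of $(X,Y)$. Then $$\lim_{n\to\infty}\mathbb{P}\Big\{n^{-1}\Big(\max_{i\le n}Y_i/X_i+1\Big)\le x\Big\}=e^{-1/x},\qquad x>0,$$ and the random variables $\max_{i\le n}Y_i/X_i$ and $\min_{i\le n}Y_i/X_i$ are asymptotically independent, in the sense that for all $x,y>0$, $$\lim_{n\to\infty}\mathbb{P}\Big\{n^{-1}\Big(\max_{i\le n}Y_i/X_i+1\Big)\le x,\ n^{-1}\Big(\max_{i\le n}X_i/Y_i+1\Big)\le y\Big\}=e^{-1/x-1/y}.$$ Furthermore, $n q_n$ converges in distribution, as $n\to\infty$, to a gamma$(2,1)$ random variable (density $t e^{-t}$, $t>0$), where $$q_n=\frac{\max_{i\le n}\{Y_i/X_i\}+\max_{i\le n}\{X_i/Y_i\}-2}{\max_{i\le n}\{Y_i/X_i\}\times\max_{i\le n}\{X_i/Y_i\}-1}.$$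
   Context: The quantity $q_n$ is called the quotient correlation coefficient of the sample $(X_i,Y_i)_{i\le n}$ of positive random variables. *)

(* Defs.v *)
From HB Require Import structures.
From mathcomp Require Import all_boot all_order all_algebra.
From mathcomp Require Import all_classical all_reals all_analysis.
Set Implicit Arguments. Unset Strict Implicit. Unset Printing Implicit Defensive.
Import Order.TTheory GRing.Theory Num.Theory numFieldNormedType.Exports.
Local Open Scope classical_set_scope.
Local Open Scope ring_scope.

Definition mutually_independent_rv (d : measure_display) (T : measurableType d)
  (R : realType) (P : probability T R) (I : eqType) (Z : I -> T -> R) : Prop :=
  forall (J : seq I) (B : I -> set R), uniq J ->
    (forall j, j \in J -> measurable (B j)) ->
    P (\bigcap_(j in [set j | j \in J]) (Z j @^-1` B j)) =
    (\prod_(j <- J) P (Z j @^-1` B j))%E.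

Definition frechet_cdf (R : realType) (x : R) : R :=
  if 0 < x then expR (- x^-1) else 0.

(** maximum of f 0, ..., f (n-1)  (for n >= 1) *)
Definition max_upto (R : realType) (n : nat) (f : nat -> R) : R :=
  \big[Num.max/f 0%N]_(i < n) f i.

Definition qcc (R : realType) (n : nat) (X Y : nat -> R) : R :=
  let M1 := max_upto n (fun i => Y i / X i) in
  let M2 := max_upto n (fun i => X i / Y i) in
  (M1 + M2 - 2) / (M1 * M2 - 1).

Definition gamma21_cdf (R : realType) (t : R) : R :=
  Rintegral (@lebesgue_measure R) `[0, t] (fun s => s * expR (- s)).

Definition cvg_in_distribution (d : measure_display) (T : measurableType d)
  (R : realType) (P : probability T R) (Z : nat -> T -> R) (F : R -> R) : Prop :=
  forall t : R, {for t, continuous F} ->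
    (P [set w | Z n w <= t]) @[n --> \oo] --> (F t)%:E.

(* Main.v *)
(* The maxima decouple because all thresholds are reached through the single
   events [Y i / X i <= a, X i / Y i <= c], whose probability is exactly
   [1 - 1/(1+a) - 1/(1+c)] once [1 <= a c]: equivalently, [X / (X + Y)] is uniform
   on [0, 1].  This law is obtained by exhausting the wedge [Y <= a X] with
   rectangles whose masses form a geometric series; carrying an arbitrary event
   [H] independent of [(X, Y)] along in that computation also yields the product
   rule over the sample, so the joint probability is an [n]-th power converging
   to [exp (- 1/x - 1/y)].

   For [q_n], put [A = n / (M1 + 1)] and [B = n / (M2 + 1)], [M1] and [M2] being
   the two maxima.  Unless [M1 M2 = 1], [A + B <= n q_n <= (A + B) / (1 - (A + B)/n)],
   so [n q_n] has the same limit law as [A + B].  As [(A, B)] is asymptotically a pair of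
   independent unit exponentials, staircase approximations of [{A + B >= t}] and
   [{A + B <= t}] give the gamma(2,1) law. *)
Require Import Defs.
From HB Require Import structures.
From mathcomp Require Import all_boot all_order all_algebra.
From mathcomp Require Import all_classical all_reals all_analysis.
From mathcomp Require Import measurable_realfun ring lra.
Import Order.TTheory GRing.Theory Num.Theory numFieldNormedType.Exports.
Local Open Scope classical_set_scope.
Local Open Scope ring_scope.

(** Lets a discretisation of mesh [1/(N+1)] conclude without any limit: only an error bound of first
    order in the mesh has to be shown. The sign of [c] is free, since [|c|] is used. *)
Lemma ler_from_harmonic (R : realType) (x y c : R) :
  (forall N : nat, x - c / N.+1%:R <= y) -> x <= y.
Proof.
move=> h; apply/ler_addgt0Pr => e e0.
have c0 : 0 <= `|c| by [].
have := archi_boundP (divr_ge0 c0 (ltW e0)).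
set N := Num.bound _ => hN.
apply: (le_trans (y := y + c / N.+1%:R)); first by rewrite -lerBlDr.
rewrite lerD2l ler_pdivrMr ?ltr0n// mulrC.
apply: (le_trans (ler_norm c)); rewrite -ler_pdivrMr//.
by apply: (le_trans (ltW hN)); rewrite ler_nat.
Qed.

(** * Measurability of quotients and finite maxima *)

Section measurability.
Context d (T : measurableType d) (R : realType).
Implicit Types f g : T -> R.

Lemma measurable_set_ler f g : measurable_fun setT f -> measurable_fun setT g ->
  measurable [set w | f w <= g w].
Proof.
by move=> mf mg; rewrite -[X in measurable X]setTI; exact: measurable_fun_le.
Qed.

Lemma measurable_set_ltr f g : measurable_fun setT f -> measurable_fun setT g ->
  measurable [set w | f w < g w].
Proof.
move=> mf mg; rewrite (_ : [set _ | _] = ~` [set w | g w <= f w]).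
  by apply: measurableC; exact: measurable_set_ler.
by apply/seteqP; split => w /=; rewrite ltNge => /negP.
Qed.

(** Inversion is discontinuous at 0, where its value is 0 by convention, so the line is split into
    [{0}] and its complement. *)
Lemma measurable_invr : measurable_fun [set: R] (@GRing.inv R).
Proof.
have m0 : measurable [set 0 : R] by exact: measurable_set1.
rewrite -(setvU [set 0 : R]); apply/measurable_funU => //.
  exact: measurableC.
split.
  apply: subspace_continuous_measurable_fun; first exact: measurableC.
  apply: continuous_in_subspaceT => x; rewrite inE/= => /eqP x0.
  exact: inv_continuous.
apply: (eq_measurable_fun (cst (0 : R))) => [x|]; last exact: measurable_cst.
by rewrite inE/= => ->; rewrite invr0.
Qed.

Lemma measurable_divr f g : measurable_fun setT f -> measurable_fun setT g ->
  measurable_fun setT (fun w => f w / g w).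
Proof.
move=> mf mg; apply: measurable_funM => //.
exact: (measurableT_comp measurable_invr mg).
Qed.

Lemma measurable_max_upto n (f : nat -> T -> R) :
  (forall i, measurable_fun setT (f i)) ->
  measurable_fun setT (fun w => max_upto n (fun i => f i w)).
Proof.
move=> mf; rewrite /max_upto; have := mf 0%N.
(* The seed of the fold is made an arbitrary measurable [b]: the induction shifts the family, while
   the seed must stay the same. *)
move: (f 0%N) => b mb; elim: n f mf => [|n IH] f mf.
  by under eq_fun do rewrite big_ord0.
under eq_fun do rewrite big_ord_recl /=.
by apply: measurable_maxr => //; exact: (IH (fun i => f i.+1)).
Qed.

End measurability.

Lemma max_upto_le (R : realType) n (f : nat -> R) x : (0 < n)%N ->
  (max_upto n f <= x) <-> (forall i, (i < n)%N -> f i <= x).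
Proof.
move=> n0; split => [/bigmax_leP[_ h] i ni|h].
  exact: (h (Ordinal ni)).
by apply/bigmax_leP; split => [|i _]; apply: h.
Qed.

Lemma le_max_upto (R : realType) n (f : nat -> R) i : (i < n)%N ->
  f i <= max_upto n f.
Proof. by move=> ni; apply: (max_upto_le _ n f _ _).1 => //; case: n ni. Qed.

(** * Probabilities as real numbers *)

Section real_probability.
Context d (T : measurableType d) (R : realType) (P : probability T R).
Local Notation pr A := (fine (P A)).
Implicit Types A B N : set T.

Lemma prE A : measurable A -> P A = (pr A)%:E.
Proof. by move=> mA; rewrite fineK// fin_num_measure. Qed.

Lemma pr_ge0 A : 0 <= pr A.
Proof. exact: fine_ge0. Qed.

Lemma pr_setT : pr [set: T] = 1.
Proof. by rewrite probability_setT. Qed.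

Lemma le_pr A B : measurable A -> measurable B -> A `<=` B -> pr A <= pr B.
Proof.
move=> mA mB AB; rewrite -lee_fin -!prE//.
by apply: le_measure => //; rewrite inE.
Qed.

Lemma prU A B : measurable A -> measurable B -> A `&` B = set0 ->
  pr (A `|` B) = pr A + pr B.
Proof.
move=> mA mB AB; apply: EFin_inj; rewrite EFinD -!prE//; last exact: measurableU.
exact: measureU.
Qed.

Lemma prIC A B : measurable A -> measurable B ->
  pr (A `&` B) + pr (A `&` ~` B) = pr A.
Proof.
move=> mA mB; rewrite -prU; last first.
- by rewrite setIACA setICr setI0.
- by apply: measurableI => //; exact: measurableC.
- exact: measurableI.
by rewrite -setIUr setUv setIT.
Qed.

Lemma prUI A B : measurable A -> measurable B ->
  pr (A `|` B) + pr (A `&` B) = pr A + pr B.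
Proof.
move=> mA mB; rewrite -(prIC B A)// -(prIC (A `|` B) A)//; last exact: measurableU.
rewrite (_ : (A `|` B) `&` A = A); last by rewrite setUK.
rewrite setIUl setICr set0U (setIC B A); ring.
Qed.

Lemma pr_sum_le n (C : 'I_n -> set T) A : (forall i, measurable (C i)) ->
  measurable A -> (forall i, C i `<=` A) ->
  (forall i j w, C i w -> C j w -> i = j) -> \sum_(i < n) pr (C i) <= pr A.
Proof.
move=> mC mA CA dC.
have -> : \sum_(i < n) pr (C i) = pr (\big[setU/set0]_(i < n) C i).
  apply: EFin_inj; rewrite -prE; last exact: bigsetU_measurable.
  rewrite measure_bigsetU_ord//.
    by rewrite -sumEFin; apply: eq_bigr => i _; rewrite -prE.
  by move=> i j _ _ [w [Ci Cj]]; exact: dC Ci Cj.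
apply: le_pr => //; first exact: bigsetU_measurable.
by elim/big_ind: _ => // U V hU hV w [/hU|/hV].
Qed.

(** Monotonicity up to a null event, since positivity of the variables is known only almost
    surely. *)
Lemma le_pr_mod A B N : measurable A -> measurable B -> measurable N ->
  pr N = 0 -> A `<=` B `|` N -> pr A <= pr B.
Proof.
move=> mA mB mN N0 AB; apply: (le_trans (y := pr (B `|` N))).
  by apply: le_pr => //; exact: measurableU.
have := prUI _ _ mB mN; have := pr_ge0 (B `&` N); rewrite N0; lra.
Qed.

Lemma pr_negl A N : measurable A -> measurable N -> pr N = 0 ->
  A `<=` N -> pr A = 0.
Proof.
by move=> mA mN N0 AN; apply/eqP; rewrite eq_le pr_ge0 andbT -N0; exact: le_pr.
Qed.

End real_probability.

(** Telescoping gives the left side as [1 - expR (- u)] times the geometric sum, and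
    [1 - expR (- u) <= u]. *)
Lemma expR_geometric_sum_ge (R : realType) (u : R) K : 0 < u ->
  1 - expR (- u) ^+ K <= u * \sum_(k < K) expR (- u) ^+ k.
Proof.
move=> u0; set r := expR (- u).
have -> : 1 - r ^+ K = (1 - r) * \sum_(k < K) r ^+ k.
  by have := subrX1 r K; lra.
apply: ler_wpM2r; first by apply: sumr_ge0 => k _; rewrite exprn_ge0// expR_ge0.
by have := expR_ge1Dx (- u); rewrite -/r; lra.
Qed.

(** * Law of the ratio of two independent unit Frechet variables *)

Section ratio.
Context d (T : measurableType d) (R : realType) (P : probability T R).
Local Notation pr A := (fine (P A)).

(* The cells [x_{k+1} < X <= x_k, Y <= a x_{k+1}] with [x_k = 1/((k+1) h)] lie
   inside the wedge and their masses form a geometric series; the mesh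
   [h = 1/(N+1)] and the number [(N+1)^2] of cells make the total mass tend to
   the full value. *)
Lemma ratio_lower_bound (H : set T) (X Y : T -> R) (a : R) :
  measurable H -> measurable_fun setT X -> measurable_fun setT Y ->
  (forall x y, 0 < x -> 0 < y ->
     pr (H `&` ([set w | X w <= x] `&` [set w | Y w <= y])) =
     pr H * expR (- x^-1 - y^-1)) ->
  0 < a ->
  pr H * (a / (1 + a)) <= pr (H `&` [set w | 0 < X w /\ Y w <= a * X w]).
Proof.
move=> mH mX mY hXY a0; set L := pr (H `&` _); set m := pr H.
have m0 : 0 <= m by exact: pr_ge0.
set s := 1 + a^-1.
have s0 : 0 < s by rewrite addr_gt0 ?invr_gt0.
have -> : a / (1 + a) = s^-1.
  by rewrite /s; field; rewrite !gt_eqF// ?addr_gt0.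
(* The two error terms are those of [r ^+ 2 >= 1 - 2 h s], as the powers start at 2, and of the
   truncation [r ^+ K <= h / s]. *)
apply: (@ler_from_harmonic _ _ _ (m / s * (s *+ 2 + s^-1))) => N.
set h : R := N.+1%:R^-1.
have h0 : 0 < h by rewrite invr_gt0.
pose x (j : nat) : R := (j.+1%:R * h)^-1.
have x0 j : 0 < x j by rewrite invr_gt0 mulr_gt0.
have xD j k : (j <= k)%N -> x k <= x j.
  move=> jk; rewrite lef_pV2 ?posrE ?mulr_gt0// ler_pM2r// ler_nat ltnS//.
set K := (N.+1 * N.+1)%N.
pose C (k : 'I_K) := H `&` ([set w | x k.+1 < X w] `&`
  ([set w | X w <= x k] `&` [set w | Y w <= a * x k.+1])).
have mle (f : T -> R) c : measurable_fun setT f -> measurable [set w | f w <= c].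
  by move=> mf; apply: measurable_set_ler => //; exact: measurable_cst.
have mlt (f : T -> R) c : measurable_fun setT f -> measurable [set w | c < f w].
  by move=> mf; apply: measurable_set_ltr => //; exact: measurable_cst.
have mC k : measurable (C k).
  apply: measurableI => //; apply: measurableI; first exact: mlt.
  by apply: measurableI; exact: mle.
set r := expR (- (h * s)).
(* The joint law gives the cell mass exactly as [m * r ^+ k.+2 * (expR h - 1)], and
   [expR h - 1 >= h]. *)
have prC (k : 'I_K) : m * h * r ^+ k.+2 <= pr (C k).
  have mD : measurable (H `&` ([set w | X w <= x k] `&` [set w | Y w <= a * x k.+1])).
    by apply: measurableI => //; apply: measurableI; exact: mle.
  have := @prIC _ _ _ P _ _ mD (mlt X (x k.+1) mX).
  rewrite hXY ?mulr_gt0// -setIA (setIC _ [set w | x k.+1 < X w]) -/(C k).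
  have -> : H `&` ([set w | X w <= x k] `&` [set w | Y w <= a * x k.+1])
      `&` ~` [set w | x k.+1 < X w] =
     H `&` ([set w | X w <= x k.+1] `&` [set w | Y w <= a * x k.+1]).
    apply/seteqP; split => w /=.
      by move=> [[? [? ?]] /negP]; rewrite -leNgt.
    move=> [? [h1 h2]]; split; last by apply/negP; rewrite -leNgt.
    by split => //; split => //; apply: le_trans h1 _; exact: xD.
  rewrite hXY ?mulr_gt0// -/m.
  have -> : - (x k)^-1 - (a * x k.+1)^-1 = k.+2%:R * - (h * s) + h.
    rewrite invfM !invrK /s -[k.+2]addn1 natrD; ring.
  have -> : - (x k.+1)^-1 - (a * x k.+1)^-1 = k.+2%:R * - (h * s).
    rewrite invfM !invrK /s; ring.
  rewrite expRD expRM_natl -/r.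
  have := expR_ge1Dx h.
  have : 0 <= m * r ^+ k.+2 by rewrite mulr_ge0// exprn_ge0// expR_ge0.
  by nra.
have sumC : \sum_(k < K) pr (C k) <= L.
  apply: pr_sum_le => //.
  - apply: measurableI => //; apply: (measurableI [set w | 0 < X w]).
      exact: mlt.
    by apply: measurable_set_ler => //; exact: measurable_funM.
  - move=> k w [Hw /= [X1 [X2 Y2]]]; split => //; split.
      exact: lt_trans X1.
    by apply: (le_trans Y2); rewrite ler_pM2l// ltW.
  - move=> i j w [_ /= [i1 [i2 _]]] [_ /= [j1 [j2 _]]]; apply: val_inj => /=.
    apply/eqP; rewrite eqn_leq; apply/andP; split; rewrite leqNgt; apply/negP => ij.
      by have := lt_le_trans j1 (le_trans i2 (xD _ _ ij)); rewrite ltxx.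
    by have := lt_le_trans i1 (le_trans j2 (xD _ _ ij)); rewrite ltxx.
have : \sum_(k < K) m * h * r ^+ k.+2 <= L.
  by apply: le_trans sumC; exact: ler_sum.
have -> : \sum_(k < K) m * h * r ^+ k.+2 = m * h * r ^+ 2 * \sum_(k < K) r ^+ k.
  by rewrite mulr_sumr; apply: eq_bigr => k _; rewrite -[(_.+2)%N]add2n exprD mulrA.
apply: le_trans.
have hs0 : 0 < h * s by rewrite mulr_gt0.
have geo := @expR_geometric_sum_ge R (h * s) K hs0.
rewrite -/r in geo.
have r01 : r ^+ 2 <= 1 by rewrite exprn_ile1 ?expR_ge0// /r expR_le1; lra.
have r2 : 1 - h * s *+ 2 <= r ^+ 2.
  by rewrite /r -expRM_natl; have := expR_ge1Dx (2%:R * - (h * s)); lra.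
(* Since [K = h^-2], the remainder [r ^+ K] is [expR (- (s / h))], and [expR u >= u]. *)
have rK : r ^+ K <= h / s.
  have -> : r ^+ K = expR (- (s / h)).
    by rewrite /r -expRM_natl /K /h natrM; congr expR; field.
  rewrite expRN -[h / s]invrK lef_pV2 ?posrE ?expR_gt0 ?invr_gt0 ?divr_gt0//.
  by rewrite invf_div; have := expR_ge1Dx (s / h); lra.
have rK0 : 0 <= r ^+ K by rewrite exprn_ge0// expR_ge0.
have -> : m / s - m / s * (s *+ 2 + s^-1) / N.+1%:R =
  m / s * (1 - h * s *+ 2 - h / s) by rewrite /h; field; rewrite gt_eqF//=.
have -> : m * h * r ^+ 2 * \sum_(k < K) r ^+ k =
  m / s * (r ^+ 2 * (h * s * \sum_(k < K) r ^+ k)) by field; rewrite gt_eqF.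
apply: ler_wpM2l; first by rewrite divr_ge0// ltW.
have : r ^+ 2 * (1 - r ^+ K) <= r ^+ 2 * (h * s * \sum_(k < K) r ^+ k).
  by apply: ler_wpM2l => //; rewrite exprn_ge0// expR_ge0.
by apply: le_trans; nra.
Qed.

End ratio.

Section ratio_law.
Context d (T : measurableType d) (R : realType) (P : probability T R).
Local Notation pr A := (fine (P A)).
Context (H : set T) (X Y : T -> R) (mH : measurable H)
  (mX : measurable_fun setT X) (mY : measurable_fun setT Y)
  (X_gt0 : pr [set w | X w <= 0] = 0)
  (joint_cdf : forall x y, 0 < x -> 0 < y ->
     pr (H `&` ([set w | X w <= x] `&` [set w | Y w <= y])) =
     pr H * expR (- x^-1 - y^-1)).

(** The wedge bound is used twice: directly, and with [X] and [Y] exchanged for the wedge [X <= c Y]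
    with [a * c < 1], which up to a null event avoids [Y / X <= a]. As [c] tends to [1/a] the two
    lower bounds add up to the mass of [H], so both are sharp. *)
Lemma ratio_law (a : R) : 0 < a ->
  pr (H `&` [set w | Y w / X w <= a]) = pr H * (a / (1 + a)).
Proof.
move=> a0.
have mle (f g : T -> R) : measurable_fun setT f -> measurable_fun setT g ->
  measurable [set w | f w <= g w] by exact: measurable_set_ler.
have mlt (f g : T -> R) : measurable_fun setT f -> measurable_fun setT g ->
  measurable [set w | f w < g w] by exact: measurable_set_ltr.
have mq : measurable [set w | Y w / X w <= a] by apply: mle => //; exact: measurable_divr.
have m0 := pr_ge0 _ _ _ P H.
apply/eqP; rewrite eq_le; apply/andP; split; last first.
  apply: le_trans (ratio_lower_bound _ _ _ P _ _ _ a mH mX mY joint_cdf a0) _.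
  apply: le_pr.
  - apply: measurableI => //; apply: (measurableI [set w | 0 < X w]).
      exact: mlt.
    by apply: mle => //; exact: measurable_funM.
  - exact: measurableI.
  - by move=> w [Hw [/= X0 YX]]; split => //=; rewrite ler_pdivrMr.
suff : pr H * (1 + a)^-1 <= pr (H `&` ~` [set w | Y w / X w <= a]).
  have := prIC _ _ _ P _ _ mH mq.
  have -> : a / (1 + a) = 1 - (1 + a)^-1 by field; rewrite gt_eqF// addr_gt0.
  lra.
apply: (@ler_from_harmonic _ _ _ (pr H)) => N.
set e : R := N.+1%:R^-1.
have e0 : 0 < e by rewrite invr_gt0.
(* Just below [1/a]: the strict inequality [a * c < 1] keeps the wedges apart, and [c / (1 + c)]
   falls short of [(1 + a)^-1] by at most [e]. *)
pose c := (a * (1 + e))^-1.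
have c0 : 0 < c by rewrite invr_gt0 mulr_gt0// addr_gt0.
have ac : a * c < 1.
  by rewrite /c ltr_pdivrMr ?mul1r ?mulr_gt0 ?addr_gt0// mulrDr mulr1 ltrDl mulr_gt0.
have joint_cdf' x y : 0 < x -> 0 < y ->
    pr (H `&` ([set w | Y w <= x] `&` [set w | X w <= y])) =
    pr H * expR (- x^-1 - y^-1).
  by move=> x0 y0; rewrite (setIC [set w | Y w <= x]) joint_cdf// addrC.
apply: (@le_trans _ _ (pr H * (c / (1 + c)))).
  rewrite -/e.
  have -> : c / (1 + c) = (1 + a + a * e)^-1.
    by rewrite /c; field; rewrite !gt_eqF//= ?mulr_gt0// ?addr_gt0// ?mulr_gt0// ?addr_gt0//.
  have u0 : 0 < 1 + a by rewrite addr_gt0.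
  have v0 : 0 < 1 + a + a * e by rewrite addr_gt0 ?mulr_gt0.
  rewrite lerBlDr -mulrDr ler_wpM2l//.
  rewrite -lerBlDl -[_^-1]mul1r -[X in _ - X]mul1r -mulNr addf_div ?gt_eqF//.
  rewrite ler_pdivrMr ?mulr_gt0//.
  have ae0 : 0 < a * e by rewrite mulr_gt0.
  have p1 : 0 < e * a * a by rewrite !mulr_gt0.
  have p2 : 0 < e * (a * e) * (1 + a) by rewrite !mulr_gt0.
  lra.
apply: le_trans (ratio_lower_bound _ _ _ P _ _ _ c mH mY mX joint_cdf' c0) _.
apply: (@le_pr_mod _ _ _ P _ _ [set w | X w <= 0]) => //.
- apply: measurableI => //; apply: (measurableI [set w | 0 < Y w]).
    exact: mlt.
  by apply: mle => //; exact: measurable_funM.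
- by apply: measurableI => //; exact: measurableC.
- exact: mle.
- move=> w [Hw [/= Y0 XY]].
  have [X0|X0] := leP (X w) 0; [by right|left; split => //=].
  rewrite ler_pdivrMr// => YX; have : Y w <= a * (c * Y w).
    by apply: (le_trans YX); rewrite ler_pM2l.
  by rewrite mulrA leNgt gtr_pMl ?ac.
Qed.

End ratio_law.

Section ratio_wedge.
Context d (T : measurableType d) (R : realType) (P : probability T R).
Local Notation pr A := (fine (P A)).

(** Inclusion-exclusion. When [1 <= a * c] the two ratio events cover everything up to a null event,
    because [Y > a X] forces [X <= c Y]; so their union has the mass of [H]. *)
Lemma ratio_wedge (H : set T) (X Y : T -> R) (a c : R) :
  measurable H -> measurable_fun setT X -> measurable_fun setT Y ->
  pr [set w | X w <= 0] = 0 -> pr [set w | Y w <= 0] = 0 ->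
  (forall x y, 0 < x -> 0 < y ->
     pr (H `&` ([set w | X w <= x] `&` [set w | Y w <= y])) =
     pr H * expR (- x^-1 - y^-1)) ->
  0 < a -> 0 < c -> 1 <= a * c ->
  pr (H `&` ([set w | Y w / X w <= a] `&` [set w | X w / Y w <= c])) =
  pr H * (1 - (1 + a)^-1 - (1 + c)^-1).
Proof.
move=> mH mX mY X_gt0 Y_gt0 joint_cdf a0 c0 ac.
have mle (f g : T -> R) : measurable_fun setT f -> measurable_fun setT g ->
  measurable [set w | f w <= g w] by exact: measurable_set_ler.
have joint_cdf' x y : 0 < x -> 0 < y ->
    pr (H `&` ([set w | Y w <= x] `&` [set w | X w <= y])) =
    pr H * expR (- x^-1 - y^-1).
  by move=> x0 y0; rewrite (setIC [set w | Y w <= x]) joint_cdf// addrC.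
have m1 : measurable (H `&` [set w | Y w / X w <= a]).
  by apply: measurableI => //; apply: mle => //; exact: measurable_divr.
have m2 : measurable (H `&` [set w | X w / Y w <= c]).
  by apply: measurableI => //; apply: mle => //; exact: measurable_divr.
have := prUI _ _ _ P _ _ m1 m2.
rewrite (ratio_law _ _ _ _ _ X Y)// (ratio_law _ _ _ _ _ Y X)// -setIIr.
set q := pr (H `&` (_ `&` _)).
have -> : pr (H `&` [set w | Y w / X w <= a] `|` H `&` [set w | X w / Y w <= c]) = pr H.
  apply/eqP; rewrite eq_le; apply/andP; split.
    by apply: le_pr => //; [exact: measurableU|move=> w [[]|[]]].
  apply: (@le_pr_mod _ _ _ P _ _ ([set w | X w <= 0] `|` [set w | Y w <= 0])) => //.
  - exact: measurableU.
  - by apply: measurableU; exact: mle.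
  - have mX0 : measurable [set w | X w <= 0] by exact: mle.
    have mY0 : measurable [set w | Y w <= 0] by exact: mle.
    have := prUI _ _ _ P _ _ mX0 mY0; rewrite X_gt0 Y_gt0.
    have := pr_ge0 _ _ _ P ([set w | X w <= 0] `|` [set w | Y w <= 0]).
    have := pr_ge0 _ _ _ P ([set w | X w <= 0] `&` [set w | Y w <= 0]).
    lra.
  - move=> w Hw /=.
    have [X0|X0] := leP (X w) 0; first by right; left.
    have [Y0|Y0] := leP (Y w) 0; first by right; right.
    left; have [h1|h1] := leP (Y w / X w) a; first by left.
    right; split => //=; rewrite ler_pdivrMr//.
    rewrite ltr_pdivlMr// in h1.
    apply: (@le_trans _ _ (a * c * X w)); first by rewrite ler_peMl// ltW.
    by rewrite (mulrC a) -mulrA ler_pM2l// ltW.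
have -> : a / (1 + a) = 1 - (1 + a)^-1 by field; rewrite gt_eqF// addr_gt0.
have -> : c / (1 + c) = 1 - (1 + c)^-1 by field; rewrite gt_eqF// addr_gt0.
lra.
Qed.

End ratio_wedge.

(** * Product rule over the pairs of the sample *)

Section product_rule.
Context d (T : measurableType d) (R : realType) (P : probability T R).
Local Notation pr A := (fine (P A)).
Context (X Y : nat -> T -> R) (mX : forall i, measurable_fun setT (X i))
  (mY : forall i, measurable_fun setT (Y i)).
Local Notation Z := (fun k : nat * bool => if k.2 then Y k.1 else X k.1).
Local Notation cyl J B := (\bigcap_(j in [set j | j \in J]) (Z j @^-1` B j)).
Context (indep : mutually_independent_rv P Z).

Lemma measurable_cyl (J : seq (nat * bool)) (B : nat * bool -> set R) :
  (forall j, j \in J -> measurable (B j)) -> measurable (cyl J B).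
Proof.
move=> mB; apply: fin_bigcap_measurable => [|[i b] /= /mB mBj].
  exact: finite_seq.
by rewrite -[X in measurable X]setTI; case: b mBj => mBj; [exact: mY|exact: mX].
Qed.

(** Turns a rectangle in pair [i] together with a cylinder on later pairs into a single cylinder,
    the form to which mutual independence applies. Indices in [J] exceed [i], so overriding [B] at
    the two coordinates of pair [i] does not affect them. *)
Lemma cyl_cons2 i (A C : set R) J (B : nat * bool -> set R) :
  (forall j, j \in J -> (i < j.1)%N) ->
  let B' := fun j => if j == (i, false) then A
                     else if j == (i, true) then C else B j in
  cyl ((i, false) :: (i, true) :: J) B' =
  (X i @^-1` A `&` Y i @^-1` C) `&` cyl J B.
Proof.
move=> hJ B'.
have B'J j : j \in J -> B' j = B j.
  move=> /hJ; case: j => j b /= ij; rewrite /B' !xpair_eqE.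
  by rewrite gtn_eqF.
apply/seteqP; split => w.
  move=> h; split; first split.
  - by have := h (i, false) (mem_head _ _); rewrite /B' /= eqxx.
  - have /h : (i, true) \in [:: (i, false), (i, true) & J] by rewrite !inE eqxx orbT.
    by rewrite /B'/= xpair_eqE andbF eqxx.
  - by move=> j /= jJ; rewrite -B'J//; apply: h; rewrite /= !inE jJ !orbT.
move=> [[h1 h2] h3] j /=; rewrite !inE => /or3P[/eqP->|/eqP->|jJ].
- by rewrite /B'/= eqxx.
- by rewrite /B'/= xpair_eqE andbF eqxx.
- by rewrite B'J//; exact: h3.
Qed.

Lemma pr_cyl_cons2 i (A C : set R) J (B : nat * bool -> set R) :
  measurable A -> measurable C -> uniq J ->
  (forall j, j \in J -> measurable (B j)) ->
  (forall j, j \in J -> (i < j.1)%N) ->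
  pr ((X i @^-1` A `&` Y i @^-1` C) `&` cyl J B) =
  pr (X i @^-1` A) * pr (Y i @^-1` C) * pr (cyl J B).
Proof.
move=> mA mC uJ mB hJ; rewrite -cyl_cons2//.
set B' := fun j => if j == (i, false) then A
                     else if j == (i, true) then C else B j.
have B'J j : j \in J -> B' j = B j.
  move=> /hJ; case: j => j b /= ij; rewrite /B' !xpair_eqE.
  by rewrite gtn_eqF.
have nJ b : (i, b) \notin J by apply/negP => /hJ /=; rewrite ltnn.
rewrite indep; last first.
- move=> j; rewrite !inE => /or3P[/eqP->|/eqP->|jJ].
  + by rewrite /B' eqxx.
  + by rewrite /B' xpair_eqE andbF eqxx.
  + by rewrite -/(B' j) B'J//; exact: mB.
- by rewrite /= !inE negb_or !nJ xpair_eqE andbF.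
rewrite !big_cons /= /B' eqxx xpair_eqE andbF eqxx /= muleA fineM; last 2 first.
- have mP (A' : set T) : measurable A' -> P A' \is a fin_num by move=> ?; exact: fin_num_measure.
  by rewrite fin_numM// mP// -[X in measurable X]setTI; [exact: mX|exact: mY].
- rewrite big_seq; elim/big_ind: _ => // [x y|j jJ]; first exact: fin_numM.
  rewrite -/(B' j) B'J// fin_num_measure// -[X in measurable X]setTI.
  by case: ifP => _; [apply: mY|apply: mX] => //; exact: mB.
rewrite fineM; last 2 first.
- by rewrite fin_num_measure// -[X in measurable X]setTI; exact: mX.
- by rewrite fin_num_measure// -[X in measurable X]setTI; exact: mY.
congr (_ * fine _); rewrite indep// big_seq [in RHS]big_seq.
by apply: eq_bigr => j jJ; rewrite -/(B' j) B'J.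
Qed.

(* Only independence of the coordinates on rectangles is available, so the pairs
   [(X i, Y i)] are processed one at a time, keeping the later ones as cylinders. *)
Lemma pr_bigcap_pairs (W : nat -> set T) (p : R) :
  (forall i, measurable (W i)) ->
  (forall i (H : set T), measurable H ->
     (forall A C, measurable A -> measurable C ->
        pr (H `&` (X i @^-1` A `&` Y i @^-1` C)) =
        pr H * (pr (X i @^-1` A) * pr (Y i @^-1` C))) ->
     pr (H `&` W i) = pr H * p) ->
  forall n J (B : nat * bool -> set R), uniq J ->
    (forall j, j \in J -> measurable (B j)) ->
    (forall j, j \in J -> (n <= j.1)%N) ->
    pr ([set w | forall i, (i < n)%N -> W i w] `&` cyl J B) =
    p ^+ n * pr (cyl J B).
Proof.
move=> mW hW; elim => [|n IH] J B uJ mB hJ.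
  by rewrite expr0 mul1r; congr (fine (P _)); apply/seteqP; split => [w []|].
have mWn k : measurable [set w | forall i, (i < k)%N -> W i w].
  elim: k => [|k mk]; first by rewrite (_ : [set _ | _] = setT)//; apply/seteqP; split.
  rewrite (_ : [set _ | _] = [set w | forall i, (i < k)%N -> W i w] `&` W k).
    exact: measurableI.
  apply/seteqP; split => w.
    by move=> h; split => [i ik|]; apply: h => //; exact: ltnW.
  by move=> [h1 h2] i; rewrite ltnS leq_eqVlt => /orP[/eqP->//|/h1].
have hJ' j : j \in J -> (n <= j.1)%N by move=> /hJ /ltnW.
have mcyl := measurable_cyl J B mB.
rewrite (_ : _ `&` _ = [set w | forall i, (i < n)%N -> W i w] `&` cyl J B `&` W n); last first.
  apply/seteqP; split => w.
    by move=> [h1 h2]; split; [split => // i ni; apply: h1; exact: ltnW|exact: h1].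
  move=> [[h1 h2] h3]; split => // i; rewrite ltnS leq_eqVlt => /orP[/eqP->//|].
  exact: h1.
rewrite hW; last 2 first.
- exact: measurableI.
(* Here [H] is the first [n] events with the cylinder on [J]. Its independence from rectangles in
   pair [n] follows by absorbing the rectangle into the cylinder and using the induction hypothesis
   for the longer list, which may contain index [n] since it only asks for indices at least [n]. *)
- move=> A C mA mC; rewrite -setIA (setIC (cyl J B)) -cyl_cons2// IH.
  + by rewrite cyl_cons2// pr_cyl_cons2// IH//; ring.
  + rewrite /= uJ andbT !inE xpair_eqE andbF /=.
    by apply/andP; split; apply/negP => /hJ /=; rewrite ltnn.
  + move=> j; rewrite !inE => /or3P[/eqP->|/eqP->|jJ].
    * by rewrite eqxx.
    * by rewrite xpair_eqE andbF eqxx.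
    * case: eqP => // _; case: eqP => // _; exact: mB.
  + by move=> j; rewrite !inE => /or3P[/eqP->|/eqP->|/hJ'].
by rewrite IH// exprSr; ring.
Qed.

End product_rule.

(** * Double limits and the gamma(2,1) survival function *)

Lemma cvg_sum_ord (R : realType) K (f : nat -> nat -> R) (l : nat -> R) :
  (forall k, (k < K)%N -> f k n @[n --> \oo] --> l k) ->
  \sum_(k < K) f k n @[n --> \oo] --> \sum_(k < K) l k.
Proof.
elim: K => [|K IH] fl.
  by under eq_fun do rewrite big_ord0; rewrite big_ord0; exact: cvg_cst.
under eq_fun do rewrite big_ord_recr /=; rewrite big_ord_recr /=.
by apply: cvgD; [apply: IH => k kK; apply: fl; exact: ltnW|exact: fl].
Qed.

(** The order of choice matters: [N] is fixed first so that the discretisation error is at most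
    [e / 2], and only then is [n] taken large for that [N]. *)
Lemma near_ge_harmonic (R : realType) (p : nat -> R) (u : nat -> nat -> R)
    (U : nat -> R) (g c e : R) :
  (forall N n, u N n <= p n) -> (forall N, u N n @[n --> \oo] --> U N) ->
  (forall N, g - c / N.+1%:R <= U N) -> 0 < e ->
  \forall n \near \oo, g - e <= p n.
Proof.
move=> up uU gU e0.
have [N hN] : exists N : nat, c / N.+1%:R <= e / 2.
  have /archi_boundP : 0 <= `|c| / (e / 2) by rewrite divr_ge0// ltW// divr_gt0.
  set N := Num.bound _ => hN; exists N.
  rewrite ler_pdivrMr// (le_trans (ler_norm _))// mulrC -ler_pdivrMr ?divr_gt0//.
  by rewrite (le_trans (ltW hN))// ler_nat.
have e2 : 0 < e / 2 by rewrite divr_gt0.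
have /cvgrPdist_le/(_ _ e2) := uU N.
apply: filterS => n /ler_normlW; have := up N n; have := gU N.
by move: hN; set q := c / _; lra.
Qed.

Lemma telescope_ord (R : realType) (f : nat -> R) K :
  \sum_(k < K) (f k - f k.+1) = f 0%N - f K.
Proof.
elim: K => [|K IH]; first by rewrite big_ord0 subrr.
by rewrite big_ord_recr /= IH; ring.
Qed.

(** For [t >= 0], the probability that a sum of two independent unit exponentials exceeds [t]. *)
Definition gamma21_surv {R : realType} (t : R) : R := (1 + t) * expR (- t).

(** By [expR (- e) >= 1 - e], the loss is at most [e * t * expR (- t) + e ^+ 2 * expR (- t)], and
    each of the two terms is at most [e]. *)
Lemma gamma21_surv_lip (R : realType) (t e : R) : 0 <= t -> 0 <= e <= 1 ->
  gamma21_surv t - e *+ 2 <= gamma21_surv (t + e).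
Proof.
move=> t0 /andP[e0 e1]; rewrite /gamma21_surv (opprD t) expRD.
have E0 := expR_ge0 (- t).
have E1 : expR (- t) <= 1 by rewrite expR_le1; lra.
have tE : t * expR (- t) <= 1.
  rewrite expRN -ler_pdivlMr ?invr_gt0 ?expR_gt0// invrK mul1r.
  by have := expR_ge1Dx t; lra.
have e_lb := expR_ge1Dx (- e).
have h : (1 + (t + e)) * expR (- t) * (1 - e) <= (1 + (t + e)) * (expR (- t) * expR (- e)).
  by rewrite -mulrA ler_wpM2l ?ler_wpM2l//; lra.
apply: le_trans h.
set E := expR (- t) in E0 E1 tE *.
have h1 : e * (t * E) <= e by nra.
have ee : e * e <= e by nra.
have h2 : e * e * E <= e by nra.
nra.
Qed.

(** * Law of a sum from limits of orthant probabilities *)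

Section staircase.
Context d (T : measurableType d) (R : realType) (P : probability T R).
Local Notation pr A := (fine (P A)).
Context (A B : nat -> T -> R) (mA : forall n, measurable_fun setT (A n))
  (mB : forall n, measurable_fun setT (B n)).
Local Notation orth n a b := ([set w | a <= A n w] `&` [set w | b <= B n w]).
Context (orth_cvg : forall a b : R, 0 <= a -> 0 <= b ->
  pr (orth n a b) @[n --> \oo] --> expR (- a - b)).

Lemma measurable_ge (f : T -> R) (c : R) : measurable_fun setT f ->
  measurable [set w | c <= f w].
Proof. by move=> mf; apply: measurable_set_ler => //; exact: measurable_cst. Qed.

Lemma measurable_orth n a b : measurable (orth n a b).
Proof. by apply: measurableI; exact: measurable_ge. Qed.

Lemma pr_strip n a a' b : a <= a' ->
  pr (orth n a b `&` ~` [set w | a' <= A n w]) = pr (orth n a b) - pr (orth n a' b).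
Proof.
move=> aa'.
have := prIC _ _ _ P _ _ (measurable_orth n a b) (measurable_ge (A n) a' (mA n)).
rewrite (_ : orth n a b `&` [set w | a' <= A n w] = orth n a' b); first by lra.
apply/seteqP; split => w /=; first by move=> [[]].
by move=> [h1 h2]; split=> //; split=> //; exact: le_trans h1.
Qed.

(** Inner staircase with [h = t / (N+1)]: the disjoint pieces [k h <= A < (k+1) h], [B >= t - k h],
    and [A >= t], [B >= 0]. Each strip is a difference of two orthants with limit mass
    [expR (- t) * (1 - expR (- h))], and the last piece has limit mass [expR (- t)]. *)
Lemma near_surv_ge t e : 0 <= t -> 0 < e ->
  \forall n \near \oo, gamma21_surv t - e <= pr [set w | t <= A n w + B n w].
Proof.
move=> t0 e0.
pose h N : R := t / N.+1%:R.
have h0 N : 0 <= h N by rewrite divr_ge0.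
pose f N k n := pr (orth n (k%:R * h N) (t - k%:R * h N)) -
  pr (orth n (k.+1%:R * h N) (t - k%:R * h N)).
pose l N (k : nat) := expR (- (k%:R * h N) - (t - k%:R * h N)) -
      expR (- (k.+1%:R * h N) - (t - k%:R * h N)).
have kh N k : (k < N.+1)%N -> 0 <= k%:R * h N <= t.
  move=> kN; rewrite mulr_ge0//= /h mulrA ler_pdivrMr// mulrC ler_wpM2l//.
  by rewrite ler_nat ltnW.
have khS N k : k.+1%:R * h N = k%:R * h N + h N.
  by rewrite -[k.+1]addn1 natrD mulrDl mul1r.
have khN N : N.+1%:R * h N = t by rewrite /h; field.
apply: (@near_ge_harmonic _ _ (fun N n => \sum_(k < N.+1) f N k n + pr (orth n t 0))
   (fun N => \sum_(k < N.+1) l N k + expR (- t - 0))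
   _ (t ^+ 2)) => //.
- move=> N n.
  have mE : measurable [set w | t <= A n w + B n w].
    by apply: measurable_ge; exact: measurable_funD.
  have mAt := measurable_ge _ t (mA n).
  rewrite -(prIC _ _ _ P _ _ mE mAt) addrC; apply: lerD.
    apply: le_pr; [exact: measurable_orth|exact: measurableI|].
    by move=> w /= [h1 h2]; split => //; lra.
  have -> : \sum_(k < N.+1) f N k n = \sum_(k < N.+1)
      pr (orth n (k%:R * h N) (t - k%:R * h N) `&` ~` [set w | k.+1%:R * h N <= A n w]).
    by apply: eq_bigr => k _; rewrite pr_strip// khS; have := h0 N; lra.
  apply: pr_sum_le.
  + move=> k; apply: measurableI; first exact: measurable_orth.
    by apply: measurableC; exact: measurable_ge.
  + by apply: measurableI => //; exact: measurableC.
  + move=> k w /= [[h1 h2] /negP h3]; split; first by lra.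
    apply/negP; move: h3; rewrite -!ltNge => h3; apply: (lt_le_trans h3).
    rewrite -[leRHS](khN N) ler_wpM2r// ler_nat; exact: ltn_ord.
  + move=> i j w /= [[i1 _] /negP]; rewrite -ltNge => i2 [[j1 _] /negP].
    rewrite -ltNge => j2; apply: val_inj => /=.
    have cmp (k j' : nat) : k%:R * h N < j'.+1%:R * h N -> (k <= j')%N.
      move=> kl; rewrite leqNgt; apply/negP => jk.
      have : j'.+1%:R * h N <= k%:R * h N by rewrite ler_wpM2r// ler_nat.
      lra.
    apply/eqP; rewrite eqn_leq.
    by rewrite (cmp _ _ (le_lt_trans i1 j2)) (cmp _ _ (le_lt_trans j1 i2)).
- move=> N; apply: cvgD; last exact: orth_cvg.
  apply: (@cvg_sum_ord _ _ (f N) (l N)) => k kN; have := kh _ _ kN; have := h0 N => hN /andP[k0 kt].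
  by apply: cvgB; apply: orth_cvg; rewrite ?khS; lra.
- move=> N.
  rewrite (eq_bigr (fun=> expR (- t) * (1 - expR (- h N)))); last first.
    move=> k _; rewrite /l mulrBr mulr1 -expRD khS; congr (expR _ - expR _); ring.
  rewrite sumr_const card_ord -(mulr_natl (expR (- t) * _)) subr0.
  have hN := h0 N; set x := h N in hN *.
  (* The quadratic loss, summed over [N+1] strips of width [x], is the allowed error
     [t ^+ 2 / (N+1)]. *)
  have x1 : x - x ^+ 2 <= 1 - expR (- x).
    have ee : expR x * expR (- x) = 1 by exact: expRxMexpNx_1.
    have e1 := expR_ge1Dx x; have e2 := expR_ge1Dx (- x); have e3 := expR_ge0 (- x).
    have : x * expR (- x) <= 1 - expR (- x) by nra.
    by apply: le_trans; rewrite expr2; nra.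
  have -> : t ^+ 2 / N.+1%:R = N.+1%:R * x ^+ 2 by rewrite /x /h; field.
  have tx : t = N.+1%:R * x by rewrite /x khN.
  have E0 := expR_ge0 (- t).
  have E1 : expR (- t) <= 1 by rewrite expR_le1; lra.
  rewrite /gamma21_surv; set E := expR (- t) in E0 E1 *.
  have N0 : 0 < N.+1%:R :> R by [].
  have : E * (N.+1%:R * (x - x ^+ 2)) <= E * (N.+1%:R * (1 - expR (- x))).
    by rewrite ler_wpM2l// ler_wpM2l.
  have : E * (N.+1%:R * x ^+ 2) <= N.+1%:R * x ^+ 2.
    by rewrite ler_piMl// mulr_ge0// sqr_ge0.
  rewrite {1}tx; lra.
Qed.

(** Inner staircase for the opposite region: [k h <= A < (k+1) h] with [0 <= B < t - (k+1) h], each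
    cell a double difference of orthants. With [near_surv_ge] this gives lower bounds on both sides
    of the line [A + B = t]; upper bounds then come from complements. *)
Lemma near_cdf_ge t e : 0 <= t -> 0 < e ->
  \forall n \near \oo, 1 - gamma21_surv t - e <= pr [set w | A n w + B n w <= t].
Proof.
move=> t0 e0.
pose h N : R := t / N.+1%:R.
have h0 N : 0 <= h N by rewrite divr_ge0.
pose b N (k : nat) := t - k.+1%:R * h N.
pose f N k n := pr (orth n (k%:R * h N) 0) - pr (orth n (k.+1%:R * h N) 0) -
  (pr (orth n (k%:R * h N) (b N k)) - pr (orth n (k.+1%:R * h N) (b N k))).
pose l N (k : nat) := expR (- (k%:R * h N) - 0) - expR (- (k.+1%:R * h N) - 0) -
  (expR (- (k%:R * h N) - b N k) - expR (- (k.+1%:R * h N) - b N k)).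
have khS N k : k.+1%:R * h N = k%:R * h N + h N.
  by rewrite -[k.+1]addn1 natrD mulrDl mul1r.
have khN N : N.+1%:R * h N = t by rewrite /h; field.
have kh N k : (k < N.+1)%N -> 0 <= b N k.
  by move=> kN; rewrite /b subr_ge0 -[leRHS](khN N) ler_wpM2r// ler_nat.
apply: (@near_ge_harmonic _ _ (fun N n => \sum_(k < N.+1) f N k n)
   (fun N => \sum_(k < N.+1) l N k)
   _ (t ^+ 2)) => //.
- move=> N n.
  pose C (k : nat) := orth n (k%:R * h N) 0 `&` ~` [set w | k.+1%:R * h N <= A n w]
     `&` ~` [set w | b N k <= B n w].
  have mst k c : measurable (orth n (k%:R * h N) c `&` ~` [set w | k.+1%:R * h N <= A n w]).
    apply: measurableI; first exact: measurable_orth.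
    by apply: measurableC; exact: measurable_ge.
  have -> : \sum_(k < N.+1) f N k n = \sum_(k < N.+1) pr (C k).
    apply: eq_bigr => k _.
    have := prIC _ _ _ P _ _ (mst k 0) (measurable_ge _ (b N k) (mB n)).
    rewrite -/(C k) pr_strip; last by rewrite khS; have := h0 N; lra.
    rewrite (_ : _ `&` _ `&` _ `&` [set w | b N k <= B n w] =
      orth n (k%:R * h N) (b N k) `&` ~` [set w | k.+1%:R * h N <= A n w]).
      by rewrite pr_strip /f; [lra|rewrite khS; have := h0 N; lra].
    have b0 := kh N k (ltn_ord k).
    apply/seteqP; split => w /=; first by move=> [[[? ?] ?] ?].
    by move=> [[? h2] ?]; do 3!split => //; exact: le_trans h2.
  apply: pr_sum_le.
  + by move=> k; apply: measurableI => //; apply: measurableC; exact: measurable_ge.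
  + apply: measurable_set_ler; last exact: measurable_cst.
    exact: measurable_funD.
  + move=> k w /= [[[_ _] /negP h1] /negP]; move: h1; rewrite -!ltNge /b; lra.
  + move=> i j w /= [[[i1 _] /negP i2] _] [[[j1 _] /negP j2] _].
    rewrite -!ltNge in i2 j2; apply: val_inj => /=.
    have cmp (k j' : nat) : k%:R * h N < j'.+1%:R * h N -> (k <= j')%N.
      move=> kl; rewrite leqNgt; apply/negP => jk.
      have : j'.+1%:R * h N <= k%:R * h N by rewrite ler_wpM2r// ler_nat.
      lra.
    apply/eqP; rewrite eqn_leq.
    by rewrite (cmp _ _ (le_lt_trans i1 j2)) (cmp _ _ (le_lt_trans j1 i2)).
- move=> N; apply: (@cvg_sum_ord _ _ (f N) (l N)) => k kN; have b0 := kh _ _ kN.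
  have k0 (j : nat) : 0 <= j%:R * h N by rewrite mulr_ge0.
  by apply: cvgB; apply: cvgB; exact: orth_cvg.
- move=> N; set x := h N; have hN : 0 <= x := h0 N.
  rewrite (eq_bigr (fun k : 'I_N.+1 => (expR (- (k%:R * x)) - expR (- (k.+1%:R * x))) -
     expR (- t) * (expR x - 1))); last first.
    move=> k _; rewrite /l !subr0; congr (_ - _); rewrite mulrBr mulr1 -expRD /b khS -/x.
    by congr (expR _ - expR _); ring.
  rewrite sumrB (telescope_ord _ (fun k => expR (- (k%:R * x)))).
  rewrite sumr_const card_ord -(mulr_natl (expR (- t) * _)) khN mul0r oppr0 expR0.
  have tx : t = N.+1%:R * x by rewrite /x khN.
  have xt : x <= t by rewrite tx ler_peMl// ler1n.
  have -> : t ^+ 2 / N.+1%:R = N.+1%:R * x ^+ 2 by rewrite /x /h; field.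
  have E0 := expR_ge0 (- t).
  have E1 : expR (- t) <= 1 by rewrite expR_le1; lra.
  have N0 : 0 < N.+1%:R :> R by [].
  have Ex : expR (- t) * expR x <= 1 by rewrite -expRD expR_le1; lra.
  have x1 : expR x - 1 <= x * expR x.
    have ee : expR x * expR (- x) = 1 by exact: expRxMexpNx_1.
    by have e2 := expR_ge1Dx (- x); have e3 := expR_gt0 x; nra.
  rewrite /gamma21_surv; set E := expR (- t) in E0 E1 Ex *.
  suff h1 : E * (expR x - 1) <= E * x + x ^+ 2.
    have : N.+1%:R * (E * (expR x - 1)) <= N.+1%:R * (E * x + x ^+ 2) by rewrite ler_wpM2l.
    rewrite {1}tx; lra.
  (* The inequality [expR x - 1 <= x * expR x] is used twice; then [E * expR x <= 1], as [x <= t],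
     makes the remainder at most [x ^+ 2]. *)
  have : E * (expR x - 1) <= E * (x + x * (x * expR x)).
    by rewrite ler_wpM2l//; nra.
  by rewrite expr2; nra.
Qed.

(** Controls the exceptional alternatives of [qcc_ge]: the level [n / 2] eventually passes the fixed
    level [c = 2 / e], for which [expR (- c) <= e / 2]. *)
Lemma near_orth_tail_le e : 0 < e ->
  \forall n \near \oo, pr (orth n (n%:R / 2) 0) <= e /\ pr (orth n 0 (n%:R / 2)) <= e.
Proof.
move=> e0; have e2 : 0 < e / 2 by rewrite divr_gt0.
set c := (e / 2)^-1; have c0 : 0 <= c by rewrite ltW// invr_gt0.
have ec : expR (- c) <= e / 2.
  rewrite expRN -[leRHS]invrK lef_pV2 ?posrE ?expR_gt0 ?invr_gt0//.
  by have := expR_ge1Dx c; rewrite -/c; lra.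
near=> n.
have cn : c <= n%:R / 2.
  rewrite ler_pdivlMr//; near: n; exact: nbhs_infty_ger.
split.
  apply: (@le_trans _ _ (pr (orth n c 0))).
    by apply: le_pr; [exact: measurable_orth..|move=> w /= [h1 h2]; split => //; lra].
  suff : `|expR (- c - 0) - pr (orth n c 0)| <= e / 2.
    by rewrite distrC subr0 => /ler_normlW; lra.
  by near: n; have /cvgrPdist_le := orth_cvg c 0 c0 (lexx 0); exact.
apply: (@le_trans _ _ (pr (orth n 0 c))).
  by apply: le_pr; [exact: measurable_orth..|move=> w /= [h1 h2]; split => //; lra].
suff : `|expR (- 0 - c) - pr (orth n 0 c)| <= e / 2.
  by rewrite distrC oppr0 add0r => /ler_normlW; lra.
by near: n; have /cvgrPdist_le := orth_cvg 0 c (lexx 0) c0; exact.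
Unshelve. all: end_near. Qed.

End staircase.

(** * The gamma(2,1) distribution function and the exponential limit *)

Lemma gamma21_cdfE (R : realType) (t : R) : 0 <= t ->
  gamma21_cdf t = 1 - gamma21_surv t.
Proof.
rewrite le_eqVlt => /orP[/eqP <-|t0].
  rewrite /gamma21_cdf /gamma21_surv set_itv1 Rintegral_set1 oppr0 expR0.
  by rewrite addr0 mulr1 subrr.
(* A primitive of the density [s * expR (- s)], for the fundamental theorem of calculus on the
   nondegenerate interval left after the case [t = 0]. *)
pose F (s : R) : R := - gamma21_surv s.
have dF (s : R) : is_derive s 1 F (s * expR (- s)).
  rewrite /F /gamma21_surv.
  apply: is_derive_eq.
  rewrite /GRing.scale /=; ring.
rewrite /gamma21_cdf /Rintegral (@continuous_FTC2 _ _ F) //=.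
- by rewrite /F /gamma21_surv oppr0 expR0; ring.
- apply: continuous_subspaceT => s; apply: cvgM; first exact: cvg_id.
  apply: (cvg_comp _ expR); last exact: continuous_expR.
  by apply: cvgN; exact: cvg_id.
- have cF (s : R) : {for s, continuous F}.
    by apply/differentiable_continuous/derivable1_diffP; exact: ex_derive.
  split => [s _||].
  + exact: ex_derive.
  + by apply: cvg_at_right_filter; exact: cF.
  + by apply: cvg_at_left_filter; exact: cF.
- by move=> s _; rewrite derive1E derive_val.
Qed.

Lemma gamma21_cdf_lt0 (R : realType) (t : R) : t < 0 -> gamma21_cdf t = 0.
Proof. by move=> t0; rewrite /gamma21_cdf set_itv_ge ?Rintegral_set0// bnd_simp -ltNge. Qed.

(* Squeeze between [exp (- c / (1 - c/n))] and [exp (- c)], by [1 + u <= exp u]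
   at [u = (c/n) / (1 - c/n)] and at [u = - c/n]. *)
Lemma cvg_expn_expR (R : realType) (c : R) : 0 <= c ->
  (1 - c / n%:R) ^+ n @[n --> \oo] --> expR (- c).
Proof.
move=> c0.
have cn0 : c / n%:R @[n --> \oo] --> 0.
  rewrite -[X in _ --> X](mulr0 c).
  apply: cvgM; first exact: cvg_cst.
  apply: (gtr0_cvgV0 _).2; last exact: cvgr_idn.
  by near=> n; rewrite ltr0n; near: n; exact: nbhs_infty_gt.
apply: (@squeeze_cvgr _ _ _ _ (fun n : nat => expR (- (c / (1 - c / n%:R))))
  (fun=> expR (- c))); last exact: cvg_cst.
  near=> n.
  have n0 : 0 < n%:R :> R by rewrite ltr0n; near: n; exact: nbhs_infty_gt.
  have cn : c < n%:R by near: n; exact: nbhs_infty_gtr.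
  set x := c / n%:R.
  have nx : n%:R * x = c by rewrite /x; field; rewrite gt_eqF.
  have x1 : 0 < 1 - x by rewrite subr_gt0 /x ltr_pdivrMr// mul1r.
  apply/andP; split.
    rewrite -[X in X / (1 - x)]nx -mulrA -mulrN expRM_natl.
    apply: lerXn2r; rewrite ?nnegrE ?expR_ge0 ?(ltW x1)//.
    rewrite expRN -[leRHS]invrK lef_pV2 ?posrE ?expR_gt0 ?invr_gt0//.
    have := expR_ge1Dx (x / (1 - x)).
    by rewrite (_ : 1 + x / (1 - x) = (1 - x)^-1)//; field; rewrite gt_eqF.
  rewrite -[X in expR (- X)]nx -(mulrN n%:R) expRM_natl.
  apply: lerXn2r; rewrite ?nnegrE ?expR_ge0 ?(ltW x1)//.
  exact: expR_ge1Dx.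
rewrite -[X in _ --> expR (- X)](_ : c / (1 - 0) = c); last by rewrite subr0 divr1.
apply: (cvg_comp _ expR); last exact: continuous_expR.
apply: cvgN; apply: cvgM; first exact: cvg_cst.
apply: cvgV; first by rewrite subr0 oner_neq0.
by apply: cvgB => //; exact: cvg_cst.
Unshelve. all: end_near. Qed.

(** * Deterministic bounds on the quotient correlation *)

Section quotient_bounds.
Context (R : realType) (n : nat) (x y : nat -> R) (n0 : (0 < n)%N)
  (x_gt0 : forall i, 0 < x i) (y_gt0 : forall i, 0 < y i).
Let M1 := max_upto n (fun i => y i / x i).
Let M2 := max_upto n (fun i => x i / y i).
Let S : R := n%:R / (M1 + 1) + n%:R / (M2 + 1).

Lemma max_ratio_gt0 : 0 < M1 /\ 0 < M2.
Proof.
split; [apply: lt_le_trans (le_max_upto _ _ (fun i => y i / x i) _ n0)|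
  apply: lt_le_trans (le_max_upto _ _ (fun i => x i / y i) _ n0)]; exact: divr_gt0.
Qed.

(** Index 0 alone contributes two reciprocal ratios. *)
Lemma max_ratio_mul_ge1 : 1 <= M1 * M2.
Proof.
have -> : 1 = (y 0%N / x 0%N) * (x 0%N / y 0%N).
  by field; rewrite !gt_eqF.
apply: ler_pM; try by rewrite divr_ge0// ltW.
  exact: (le_max_upto _ _ (fun i => y i / x i) _ n0).
exact: (le_max_upto _ _ (fun i => x i / y i) _ n0).
Qed.

Lemma max_ratio_add_ge2 : 2 <= M1 + M2.
Proof.
have [h1 h2] := max_ratio_gt0; have h3 := max_ratio_mul_ge1.
have h4 := sqr_ge0 (M1 - M2); rewrite leNgt; apply/negP => h5.
nra.
Qed.

Lemma qcc_ge0 : 0 <= qcc n x y.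
Proof.
rewrite /qcc -/M1 -/M2; apply: divr_ge0; rewrite subr_ge0.
  exact: max_ratio_add_ge2.
exact: max_ratio_mul_ge1.
Qed.

(* The exceptional case is [M1 * M2 = 1], where the denominator of [qcc]
   vanishes and the quotient is [0] by convention. *)
Lemma qcc_ge (t : R) : n%:R * qcc n x y <= t ->
  [\/ S <= t, n%:R / 2 <= n%:R / (M1 + 1) | n%:R / 2 <= n%:R / (M2 + 1)].
Proof.
have [h1 h2] := max_ratio_gt0; have h3 := max_ratio_mul_ge1.
have nR : 0 < n%:R :> R by rewrite ltr0n.
rewrite /qcc -/M1 -/M2.
have [M1le|M1gt] := leP M1 1.
  by move=> _; apply: Or32; rewrite ler_pM2l// lef_pV2 ?posrE; lra.
have [M2le|M2gt] := leP M2 1.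
  by move=> _; apply: Or33; rewrite ler_pM2l// lef_pV2 ?posrE; lra.
have p1 : 0 < M1 * M2 - 1 by nra.
move=> h; apply: Or31; apply: le_trans h.
rewrite /S -mulrDr ler_pM2l// -[(M1 + 1)^-1]mul1r -[(M2 + 1)^-1]mul1r.
rewrite addf_div ?gt_eqF//; [|lra..].
rewrite ler_pdivrMr; last by rewrite mulr_gt0//; lra.
rewrite mulrAC ler_pdivlMr//.
(* The cleared inequality [(M1 + M2 + 2) (M1 M2 - 1) <= (M1 + M2 - 2) (M1 + 1) (M2 + 1)] reduces to
   [4 M1 M2 <= (M1 + M2) ^+ 2]. *)
have := sqr_ge0 (M1 - M2); nra.
Qed.

(** For [S < n] the hypothesis is [S / (1 - S / n) <= t] without denominators. If [M1 M2 > 1], that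
    quotient equals [n (M1 + M2 + 2) / (M1 M2 - 1)], which differs from [n * qcc] only by [+ 2] in
    place of [- 2]. *)
Lemma qcc_le (t : R) : 0 <= t -> S * (n%:R + t) <= n%:R * t ->
  n%:R * qcc n x y <= t.
Proof.
have [h1 h2] := max_ratio_gt0; have h3 := max_ratio_mul_ge1.
have nR : 0 < n%:R :> R by rewrite ltr0n.
move=> t0; rewrite /qcc -/M1 -/M2.
move: h3; rewrite le_eqVlt => /orP[/eqP <-|h3 h].
  by rewrite subrr invr0 !mulr0.
rewrite mulrA ler_pdivrMr ?subr_gt0//.
have q0 : 0 < (M1 + 1) * (M2 + 1) by rewrite mulr_gt0//; lra.
have ES : S = n%:R * (M1 + M2 + 2) / ((M1 + 1) * (M2 + 1)).
  by rewrite /S; field; rewrite !gt_eqF//; lra.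
move: h; rewrite ES mulrAC ler_pdivrMr// -!mulrA ler_pM2l//.
nra.
Qed.

End quotient_bounds.

(** The shift by 1 in the normalisation makes the threshold [a = n x - 1], so that [a / (1 + a)] is
    exactly [1 - x^-1 / n]. The family [U] is abstract in order to serve both ratios. *)
Lemma cvg_max_marginal (d : measure_display) (T : measurableType d) (R : realType)
    (P : probability T R) (U : nat -> T -> R) (x : R) :
  (forall (a : R) n, 0 < a ->
     fine (P [set w | forall i, (i < n)%N -> U i w <= a]) = (a / (1 + a)) ^+ n) ->
  0 < x ->
  fine (P [set w | n%:R^-1 * (max_upto n (fun i => U i w) + 1) <= x])
    @[n --> \oo] --> expR (- x^-1).
Proof.
move=> hU x0; have xV : 0 < x^-1 by rewrite invr_gt0.
apply: cvg_trans (cvg_expn_expR _ _ (ltW xV)); apply: near_eq_cvg; near=> n.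
have n0 : (0 < n)%N by near: n; exact: nbhs_infty_gt.
have nR : 0 < n%:R :> R by rewrite ltr0n.
have nx : 1 < n%:R * x.
  by rewrite -ltr_pdivrMr// mul1r; near: n; exact: nbhs_infty_gtr.
rewrite (_ : [set _ | _] = [set w | forall i, (i < n)%N -> U i w <= n%:R * x - 1]).
  rewrite hU; last by rewrite subr_gt0.
  by congr (_ ^+ _); field; rewrite !gt_eqF//=; lra.
apply/seteqP; split => w /=; rewrite ler_pdivrMl// -lerBrDr.
  exact: (max_upto_le _ _ (fun i => U i w) _ n0).1.
exact: (max_upto_le _ _ (fun i => U i w) _ n0).2.
Unshelve. all: end_near. Qed.

(** * Limit laws for the sample *)

Section quotient_correlation.
Context (d : measure_display) (T : measurableType d) (R : realType)
  (P : probability T R) (X Y : nat -> T -> R)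
  (mX : forall i, measurable_fun setT (X i))
  (mY : forall i, measurable_fun setT (Y i))
  (indep : mutually_independent_rv P
             (fun k : nat * bool => if k.2 then Y k.1 else X k.1))
  (cdfX : forall i (x : R), P [set w | X i w <= x] = (frechet_cdf x)%:E)
  (cdfY : forall i (x : R), P [set w | Y i w <= x] = (frechet_cdf x)%:E).
Local Notation pr A := (fine (P A)).
Let M1 n w := max_upto n (fun i => Y i w / X i w).
Let M2 n w := max_upto n (fun i => X i w / Y i w).
Let A n w : R := n%:R / (M1 n w + 1).
Let B n w : R := n%:R / (M2 n w + 1).

Let mM1 n : measurable_fun setT (M1 n).
Proof.
by apply: (measurable_max_upto _ _ _ n (fun i w => Y i w / X i w)) => i;
  exact: measurable_divr.
Qed.

Let mM2 n : measurable_fun setT (M2 n).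
Proof.
by apply: (measurable_max_upto _ _ _ n (fun i w => X i w / Y i w)) => i;
  exact: measurable_divr.
Qed.

Let mA n : measurable_fun setT (A n).
Proof.
apply: measurable_divr; first exact: measurable_cst.
by apply: measurable_funD => //; exact: measurable_cst.
Qed.

Let mB n : measurable_fun setT (B n).
Proof.
apply: measurable_divr; first exact: measurable_cst.
by apply: measurable_funD => //; exact: measurable_cst.
Qed.

Let mM (M : nat -> T -> R) n (c : R) : (forall n, measurable_fun setT (M n)) ->
  measurable [set w | n%:R^-1 * (M n w + 1) <= c].
Proof.
move=> mM; apply: measurable_set_ler; last exact: measurable_cst.
apply: measurable_funM; first exact: measurable_cst.
by apply: measurable_funD => //; exact: measurable_cst.
Qed.

Let frechet_gt0 (x : R) : 0 < x -> frechet_cdf x = expR (- x^-1).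
Proof. by move=> x0; rewrite /frechet_cdf x0. Qed.

Let X_gt0 i : pr [set w | X i w <= 0] = 0.
Proof. by rewrite cdfX /frechet_cdf ltxx. Qed.

Let Y_gt0 i : pr [set w | Y i w <= 0] = 0.
Proof. by rewrite cdfY /frechet_cdf ltxx. Qed.

(** The null event off which all variables are positive at once; ratios and maxima are compared
    pointwise only outside it. *)
Let N := \bigcup_i ([set w | X i w <= 0] `|` [set w | Y i w <= 0]).

Let mN : measurable N.
Proof.
apply: bigcup_measurable => i _.
by apply: measurableU; apply: measurable_set_ler => //; exact: measurable_cst.
Qed.

Let prN : pr N = 0.
Proof.
rewrite measure_negligible//; apply: negligible_bigcup => i.
have mle (f : T -> R) : measurable_fun setT f -> measurable [set w | f w <= 0].
  by move=> mf; apply: measurable_set_ler => //; exact: measurable_cst.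
have X0 : P [set w | X i w <= 0] = 0%E by rewrite cdfX /frechet_cdf ltxx.
have Y0 : P [set w | Y i w <= 0] = 0%E by rewrite cdfY /frechet_cdf ltxx.
by apply: negligibleU; apply/negligibleP => //; exact: mle.
Qed.

Let notN w : ~ N w -> (forall i, 0 < X i w) /\ (forall i, 0 < Y i w).
Proof.
by move=> nN; split => i; rewrite ltNge; apply/negP => h; apply: nN;
  exists i => //; [left|right].
Qed.

Let pr_eq_mod (E F : set T) : measurable E -> measurable F ->
  (forall w, ~ N w -> E w <-> F w) -> pr E = pr F.
Proof.
move=> mE mF h; apply/eqP; rewrite eq_le.
apply/andP; split; apply: (@le_pr_mod _ _ _ P _ _ N) => // w Ew;
  by have [?|/h EF] := pselect (N w); [right|left; apply/EF].
Qed.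

(** The product rule with no later coordinates, its rectangle condition specialised to lower
    half-lines, where the Frechet laws make it the joint distribution function used by the ratio
    lemmas. *)
Let pr_all_pairs (W : nat -> set T) (p : R) n : (forall i, measurable (W i)) ->
  (forall i (H : set T), measurable H ->
    (forall x y, 0 < x -> 0 < y ->
      pr (H `&` ([set w | X i w <= x] `&` [set w | Y i w <= y])) =
      pr H * expR (- x^-1 - y^-1)) ->
    pr (H `&` W i) = pr H * p) ->
  pr [set w | forall i, (i < n)%N -> W i w] = p ^+ n.
Proof.
move=> mW hW.
have := @pr_bigcap_pairs _ _ _ P X Y mX mY indep W p mW _ n [::] (fun=> setT).
rewrite (_ : \bigcap_(j in [set j | j \in [::]]) _ = setT); last first.
  by apply/seteqP; split => // w _ j.
rewrite setIT pr_setT mulr1; apply => // i H mH hH; apply: hW => // x y x0 y0.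
have mle (c : R) : measurable [set v : R | v <= c].
  apply: measurable_set_ler; [exact: measurable_id|exact: measurable_cst].
rewrite (hH [set v | v <= x] [set v | v <= y])//.
rewrite (_ : X i @^-1` _ = [set w | X i w <= x])//.
rewrite (_ : Y i @^-1` _ = [set w | Y i w <= y])//.
by rewrite cdfX cdfY /= !frechet_gt0// expRD.
Qed.

Let pr_all_YX (a : R) n : 0 < a ->
  pr [set w | forall i, (i < n)%N -> Y i w / X i w <= a] = (a / (1 + a)) ^+ n.
Proof.
move=> a0; apply: (pr_all_pairs (fun i => [set w | Y i w / X i w <= a])).
  by move=> i; apply: measurable_set_ler; [exact: measurable_divr|exact: measurable_cst].
by move=> i H mH hH; exact: ratio_law.
Qed.

Let pr_all_XY (a : R) n : 0 < a ->
  pr [set w | forall i, (i < n)%N -> X i w / Y i w <= a] = (a / (1 + a)) ^+ n.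
Proof.
move=> a0; apply: (pr_all_pairs (fun i => [set w | X i w / Y i w <= a])).
  by move=> i; apply: measurable_set_ler; [exact: measurable_divr|exact: measurable_cst].
move=> i H mH hH; apply: ratio_law => // x y x0 y0.
by rewrite (setIC [set w | Y i w <= x]) hH// addrC.
Qed.

Let cvg_M1 (x : R) : 0 < x ->
  pr [set w | n%:R^-1 * (M1 n w + 1) <= x] @[n --> \oo] --> expR (- x^-1).
Proof.
exact: (cvg_max_marginal _ _ _ _ (fun i w => Y i w / X i w)).
Qed.

Let cvg_M2 (x : R) : 0 < x ->
  pr [set w | n%:R^-1 * (M2 n w + 1) <= x] @[n --> \oo] --> expR (- x^-1).
Proof.
exact: (cvg_max_marginal _ _ _ _ (fun i w => X i w / Y i w)).
Qed.

(** With thresholds [n x - 1] and [n y - 1] the wedge probability is exactly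
    [1 - (x^-1 + y^-1) / n]. *)
Let cvg_M1_M2 (x y : R) : 0 < x -> 0 < y ->
  pr [set w | n%:R^-1 * (M1 n w + 1) <= x /\ n%:R^-1 * (M2 n w + 1) <= y]
    @[n --> \oo] --> expR (- x^-1 - y^-1).
Proof.
move=> x0 y0; have c0 : 0 <= x^-1 + y^-1 by rewrite addr_ge0// invr_ge0 ltW.
rewrite -opprD; apply: cvg_trans (cvg_expn_expR _ _ c0); apply: near_eq_cvg; near=> n.
have n0 : (0 < n)%N by near: n; exact: nbhs_infty_gt.
have nR : 0 < n%:R :> R by rewrite ltr0n.
(* Both thresholds then exceed 1, so their product is at least 1, as [ratio_wedge] demands. *)
have nx : 2 < n%:R * x.
  by rewrite -ltr_pdivrMr//; near: n; exact: nbhs_infty_gtr.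
have ny : 2 < n%:R * y.
  by rewrite -ltr_pdivrMr//; near: n; exact: nbhs_infty_gtr.
rewrite (_ : [set _ | _] = [set w | forall i, (i < n)%N ->
    ([set w | Y i w / X i w <= n%:R * x - 1] `&`
     [set w | X i w / Y i w <= n%:R * y - 1]) w]); last first.
  apply/seteqP; split => w /=; rewrite !ler_pdivrMl// -!lerBrDr.
    move=> [h1 h2] i ni; split.
      exact: (max_upto_le _ _ (fun i => Y i w / X i w) _ n0).1.
    exact: (max_upto_le _ _ (fun i => X i w / Y i w) _ n0).1.
  move=> h; split.
    by apply: (max_upto_le _ _ (fun i => Y i w / X i w) _ n0).2 => i /h[].
  by apply: (max_upto_le _ _ (fun i => X i w / Y i w) _ n0).2 => i /h[].
rewrite (pr_all_pairs _ (1 - (n%:R * x)^-1 - (n%:R * y)^-1)).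
- by congr (_ ^+ _); rewrite !invfM; ring.
- move=> i; apply: measurableI; apply: measurable_set_ler;
    try exact: measurable_cst; exact: measurable_divr.
- move=> i H mH hH; rewrite ratio_wedge//; [|lra|lra|nra].
  by congr (_ * (_ - _^-1 - _^-1)); ring.
Unshelve. all: end_near. Qed.

Let good n w : (0 < n)%N -> ~ N w -> 0 < M1 n w /\ 0 < M2 n w.
Proof. by move=> n0 /notN[? ?]; exact: max_ratio_gt0. Qed.

Let ge_div n (a M : R) : (0 < n)%N -> 0 < a -> 0 < M ->
  (a <= n%:R / (M + 1)) = (n%:R^-1 * (M + 1) <= a^-1).
Proof.
move=> n0 a0 M0; rewrite ler_pdivlMr ?addr_gt0// ler_pdivrMl ?ltr0n//.
by rewrite ler_pdivlMr// mulrC.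
Qed.

(** Positive levels are inverted into thresholds on the maxima. A zero level has no such threshold,
    but [0 <= A] and [0 <= B] hold almost surely for [n > 0], so those cases fall back on the
    marginal limits or on total mass 1. *)
Let orth_cvg (a b : R) : 0 <= a -> 0 <= b ->
  pr ([set w | a <= A n w] `&` [set w | b <= B n w]) @[n --> \oo]
    --> expR (- a - b).
Proof.
have mo n c e : measurable ([set w | c <= A n w] `&` [set w | e <= B n w]).
  exact: measurable_orth.
have A0 n w : (0 < n)%N -> ~ N w -> 0 <= A n w.
  by move=> n0 /(good _ _ n0)[h1 _]; rewrite divr_ge0// addr_ge0// ltW.
have B0 n w : (0 < n)%N -> ~ N w -> 0 <= B n w.
  by move=> n0 /(good _ _ n0)[_ h2]; rewrite divr_ge0// addr_ge0// ltW.
rewrite le_eqVlt => /orP[/eqP <-|a0]; rewrite le_eqVlt => /orP[/eqP <-|b0].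
- rewrite subr0 oppr0 expR0 -(pr_setT _ _ _ P).
  apply: cvg_near_cst; near=> n.
  have n0 : (0 < n)%N by near: n; exact: nbhs_infty_gt.
  by apply: pr_eq_mod => // w nN; split => // _; split; [exact: A0|exact: B0].
- rewrite oppr0 add0r -[b in X in _ --> X]invrK.
  have bV : 0 < b^-1 by rewrite invr_gt0.
  apply: cvg_trans (cvg_M2 _ bV); apply: near_eq_cvg; near=> n.
  have n0 : (0 < n)%N by near: n; exact: nbhs_infty_gt.
  apply: pr_eq_mod => //; first exact: (mM M2).
  move=> w nN; have [h1 h2] := good _ _ n0 nN.
  rewrite /= -ge_div//; split => [h|[]//]; split => //; exact: A0.
- rewrite subr0 -[a in X in _ --> X]invrK.
  have aV : 0 < a^-1 by rewrite invr_gt0.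
  apply: cvg_trans (cvg_M1 _ aV); apply: near_eq_cvg; near=> n.
  have n0 : (0 < n)%N by near: n; exact: nbhs_infty_gt.
  apply: pr_eq_mod => //; first exact: (mM M1).
  move=> w nN; have [h1 h2] := good _ _ n0 nN.
  rewrite /= -ge_div//; split => [h|[]//]; split => //; exact: B0.
- rewrite -[a in X in _ --> X]invrK -[b in X in _ --> X]invrK.
  have aV : 0 < a^-1 by rewrite invr_gt0.
  have bV : 0 < b^-1 by rewrite invr_gt0.
  apply: cvg_trans (cvg_M1_M2 _ _ aV bV); apply: near_eq_cvg; near=> n.
  have n0 : (0 < n)%N by near: n; exact: nbhs_infty_gt.
  apply: pr_eq_mod => //; first by apply: measurableI; [exact: (mM M1)|exact: (mM M2)].
  move=> w nN; have [h1 h2] := good _ _ n0 nN.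
  by rewrite /= -!ge_div.
Unshelve. all: end_near. Qed.

Let q n w := n%:R * qcc n (fun i => X i w) (fun i => Y i w).

Let mq n (t : R) : measurable [set w | q n w <= t].
Proof.
apply: measurable_set_ler; last exact: measurable_cst.
apply: measurable_funM; first exact: measurable_cst.
apply: measurable_divr.
  apply: measurable_funB; last exact: measurable_cst.
  by apply: measurable_funD; [exact: (mM1 n)|exact: (mM2 n)].
apply: measurable_funB; last exact: measurable_cst.
by apply: measurable_funM; [exact: (mM1 n)|exact: (mM2 n)].
Qed.

Let q_lt0 n (t : R) : t < 0 -> (0 < n)%N -> pr [set w | q n w <= t] = 0.
Proof.
move=> t0 n0; apply: (@pr_negl _ _ _ P _ N) => // w /= qt.
apply: contrapT => /notN[h1 h2].
have : 0 <= q n w by rewrite mulr_ge0//; exact: qcc_ge0.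
lra.
Qed.

(** The event [q <= t] is split by [A + B >= t + dl]. Where that holds, [qcc_ge] leaves only the two
    tails at level [n / 2]; the shift [dl] is what excludes the alternative [A + B <= t]. *)
Let q_upper (t e : R) : 0 <= t -> 0 < e ->
  \forall n \near \oo, pr [set w | q n w <= t] <= 1 - gamma21_surv t + e.
Proof.
move=> t0 e0.
(* Error budget: two tails and the staircase cost [e / 4] each, and the shift costs
   [2 dl <= e / 4]. *)
pose dl := Num.min 1 (e / 8).
have dl0 : 0 < dl by rewrite lt_min ltr01 divr_gt0.
have dle : dl <= e / 8 by rewrite ge_min lexx orbT.
have dl1 : 0 <= dl <= 1 by rewrite ltW//= ge_min lexx.
have e4 : 0 < e / 4 by rewrite divr_gt0.
have td0 : 0 <= t + dl by lra.
near=> n.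
have n0 : (0 < n)%N by near: n; exact: nbhs_infty_gt.
have hs : gamma21_surv (t + dl) - e / 4 <= pr [set w | t + dl <= A n w + B n w].
  by near: n; exact: near_surv_ge.
have [ha hb] : pr ([set w | n%:R / 2 <= A n w] `&` [set w | 0 <= B n w]) <= e / 4 /\
   pr ([set w | 0 <= A n w] `&` [set w | n%:R / 2 <= B n w]) <= e / 4.
  by near: n; exact: near_orth_tail_le.
set S := [set w | t + dl <= A n w + B n w] in hs.
have mS : measurable S by apply: measurable_ge; exact: measurable_funD.
set TA := _ `&` _ in ha; set TB := _ `&` _ in hb.
have mTA : measurable TA by exact: measurable_orth.
have mTB : measurable TB by exact: measurable_orth.
have h1 := prIC _ _ _ P _ _ (mq n t) mS.
have h2 : pr ([set w | q n w <= t] `&` S) <= pr (TA `|` TB).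
  apply: (@le_pr_mod _ _ _ P _ _ N) => //; [exact: measurableI|exact: measurableU|].
  move=> w [/= qt Sw]; have [?|nN] := pselect (N w); [by right|left].
  have [p1 p2] := notN w nN.
  have [g1 g2] := good _ _ n0 nN.
  have A0 : 0 <= A n w by rewrite divr_ge0// addr_ge0// ltW.
  have B0 : 0 <= B n w by rewrite divr_ge0// addr_ge0// ltW.
  have [h|h|h] := qcc_ge _ _ _ _ n0 p1 p2 _ qt.
  - have : A n w + B n w <= t by exact: h.
    move: Sw; rewrite /S /=; lra.
  - by left.
  - by right.
have h3 := prUI _ _ _ P _ _ mTA mTB.
have h4 := pr_ge0 _ _ _ P (TA `&` TB).
have h5 : pr ([set w | q n w <= t] `&` ~` S) <= pr (~` S).
  apply: le_pr; [|exact: measurableC|by move=> w []].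
  by apply: measurableI => //; exact: measurableC.
have h6 := prIC _ _ _ P _ _ measurableT mS.
rewrite !setTI pr_setT in h6.
have := gamma21_surv_lip _ _ _ t0 dl1.
lra.
Unshelve. all: end_near. Qed.

(** For [t > 0] and large [n], [A + B <= t - dl] implies [q <= t] by [qcc_le], off the null event.
    At [t = 0] the left side is [- e]. *)
Let q_lower (t e : R) : 0 <= t -> 0 < e ->
  \forall n \near \oo, 1 - gamma21_surv t - e <= pr [set w | q n w <= t].
Proof.
rewrite le_eqVlt => /orP[/eqP <-|t0] e0.
  apply: nearW => n; apply: (@le_trans _ _ 0); last exact: pr_ge0.
  by rewrite /gamma21_surv oppr0 expR0; lra.
pose dl := Num.min t (Num.min 1 (e / 8)).
have dl0 : 0 < dl by rewrite !lt_min t0 ltr01 divr_gt0.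
have dle : dl <= e / 8 by rewrite !ge_min lexx !orbT.
have dl1 : 0 <= dl <= 1 by rewrite ltW//= !ge_min lexx orbT.
have dlt : dl <= t by rewrite ge_min lexx.
have e4 : 0 < e / 4 by rewrite divr_gt0.
have td0 : 0 <= t - dl by lra.
near=> n.
have n0 : (0 < n)%N by near: n; exact: nbhs_infty_gt.
have hs : 1 - gamma21_surv (t - dl) - e / 4 <= pr [set w | A n w + B n w <= t - dl].
  by near: n; exact: near_cdf_ge.
(* Equivalent to [(t - dl) * t <= n * dl], hence true for large [n]; it is the hypothesis of
   [qcc_le] at [S = t - dl]. *)
have nt : (t - dl) * (n%:R + t) <= n%:R * t.
  have : (t - dl) * t / dl <= n%:R by near: n; exact: nbhs_infty_ger.
  by rewrite ler_pdivrMr//; lra.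
have h2 : pr [set w | A n w + B n w <= t - dl] <= pr [set w | q n w <= t].
  apply: (@le_pr_mod _ _ _ P _ _ N) => //.
    by apply: measurable_set_ler; [exact: measurable_funD|exact: measurable_cst].
  move=> w /= hw; have [?|nN] := pselect (N w); [by right|left].
  have [p1 p2] := notN w nN.
  apply: qcc_le => //; first exact: ltW.
  by apply: le_trans nt; rewrite ler_wpM2r// addr_ge0// ltW.
have := gamma21_surv_lip _ _ _ td0 dl1; rewrite subrK.
lra.
Unshelve. all: end_near. Qed.

Let cvg_pr (E : nat -> set T) (l : R) : (forall n, measurable (E n)) ->
  pr (E n) @[n --> \oo] --> l -> P (E n) @[n --> \oo] --> l%:E.
Proof.
by move=> mE El; apply: cvg_EFin => //; apply: nearW => n; exact: fin_num_measure.
Qed.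

Lemma cvg_max_ratio (x : R) : 0 < x ->
  P [set w | n%:R^-1 * (max_upto n (fun i => Y i w / X i w) + 1) <= x]
    @[n --> \oo] --> (expR (- x^-1))%:E.
Proof.
by move=> x0; apply: cvg_pr; [move=> n; exact: (mM M1)|exact: cvg_M1].
Qed.

Lemma cvg_max_ratios (x y : R) : 0 < x -> 0 < y ->
  P [set w | n%:R^-1 * (max_upto n (fun i => Y i w / X i w) + 1) <= x /\
             n%:R^-1 * (max_upto n (fun i => X i w / Y i w) + 1) <= y]
    @[n --> \oo] --> (expR (- x^-1 - y^-1))%:E.
Proof.
move=> x0 y0; apply: cvg_pr; last exact: cvg_M1_M2.
by move=> n; apply: measurableI; [exact: (mM M1)|exact: (mM M2)].
Qed.

Lemma cvg_qcc_gamma21 : cvg_in_distribution P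
  (fun n w => n%:R * qcc n (fun i => X i w) (fun i => Y i w)) (@gamma21_cdf R).
Proof.
move=> t _; apply: cvg_pr; first by move=> n; exact: mq.
have [t0|t0] := ltP t 0.
  rewrite gamma21_cdf_lt0//.
  apply: cvg_near_cst; near=> n.
  by rewrite q_lt0//; near: n; exact: nbhs_infty_gt.
rewrite gamma21_cdfE//; apply/cvgrPdist_le => e e0; near=> n.
have h1 : pr [set w | q n w <= t] <= 1 - gamma21_surv t + e by near: n; exact: q_upper.
have h2 : 1 - gamma21_surv t - e <= pr [set w | q n w <= t] by near: n; exact: q_lower.
by rewrite distrC ler_distl h1 h2.
Unshelve. all: end_near. Qed.

End quotient_correlation.

Theorem theorem3p1 (d : measure_display) (T : measurableType d) (R : realType)
  (P : probability T R) (X Y : nat -> T -> R)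
  (mX : forall i, measurable_fun setT (X i))
  (mY : forall i, measurable_fun setT (Y i))
  (indep : mutually_independent_rv P
             (fun k : nat * bool => if k.2 then Y k.1 else X k.1))
  (cdfX : forall i (x : R), P [set w | X i w <= x] = (frechet_cdf x)%:E)
  (cdfY : forall i (x : R), P [set w | Y i w <= x] = (frechet_cdf x)%:E) :
  (forall x : R, 0 < x ->
     (P [set w | n%:R^-1 * (max_upto n (fun i => Y i w / X i w) + 1) <= x])
       @[n --> \oo] --> (expR (- x^-1))%:E)
  /\
  (forall x y : R, 0 < x -> 0 < y ->
     (P [set w | n%:R^-1 * (max_upto n (fun i => Y i w / X i w) + 1) <= x /\
                 n%:R^-1 * (max_upto n (fun i => X i w / Y i w) + 1) <= y])
       @[n --> \oo] --> (expR (- x^-1 - y^-1))%:E)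
  /\
  cvg_in_distribution P
    (fun n w => n%:R * qcc n (fun i => X i w) (fun i => Y i w)) (@gamma21_cdf R).
Proof.
split; first by move=> x; exact: cvg_max_ratio.
by split; [move=> x y; exact: cvg_max_ratios|exact: cvg_qcc_gamma21].
Qed.
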